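(* Let $(W,S)$ be a Coxeter system of finite rank and $u,v\in W$ with $u\leq_R v$. Then the Coxeter complex $C(u,v)$ is linearly shellable.
   Context: $\ell$ is the length function; $u\le_R v$ iff $\ell(v)=\ell(u)+\ell(u^{-1}v)$; $[u,v]_R=\{w:u\le_R w\le_R v\}$. For $J\subseteq S$, $W^J=\{x:\ell(x)<\ell(xs)\ \forall s\in J\}$, each $x=x^Jx_J$ uniquely with $x^J\in W^J$, $x_J\in\langle J\rangle$, lengths adding; $P^{(s)}(x):=x^{S\setminus\{s\}}$; $P(w):=\{(P^{(s)}(w),s):s\in S\}$. $C(u,v)$ is the pure simplicial complex of dimension $|S|-1$ with facets $P(w)$, $w\in[u,v]_R$ (vertex set $\bigcup_{w}P(w)$). For a pure simplicial complex $X$ of dimension $d$ with $n$ vertices: a bijection $\sigma:V(X)\to[n]$ induces $\sigma_X:X\to[n]^{d+1}_<$ (facets as increasing $(d+1)$-tuples); $[n]^{d+1}_<$ carries the componentwise (Bruhat/Gale) order $x\le y$ iff $x_i\le y_i$ for all $i$. A sequence $(C_1,\dots,C_h)$ of distinct elements of $[n]^k_<$ (viewed as $k$-subsets) is a shelling order if for all $i<j$ there is $r<j$ with $C_r=C_j+\{a,b\}$ (symmetric difference), $a\in C_j\setminus C_i$, $b\in C_r\setminus C_j$. $X$ is linearly shellable if some such $\sigma$ makes the induced subposet $\operatorname{im}(\sigma_X)\subseteq[n]^{d+1}_<$ have a linear extension which is a shelling order. *)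

(* Defs.v *)
From mathcomp Require Import all_boot.
From mathcomp Require Import finmap.
From mathcomp Require Import boolp classical_sets functions.

Set Implicit Arguments.
Unset Strict Implicit.
Unset Printing Implicit Defensive.

Local Open Scope classical_set_scope.
Local Open Scope group_scope.

(** * Coxeter systems *)

Section Coxeter.
Variables (W : groupType) (S : {fset W}).

Definition word_prod (x : seq S) : W := \prod_(s <- x) val s.

(* The value 0 of [m] encodes the absence of a relation (m(s,t) = oo). *)
Definition coxeter_matrix (m : S -> S -> nat) : Prop :=
  (forall s t, m s t = m t s) /\ (forall s t, m s t = 1%N <-> s = t).

(* The congruence on the free monoid S* generated by the insertions and
   deletions of the words (s t)^m(s,t).  As m(s,s) = 1, each letter is its own
   inverse in the quotient, so the quotient monoid is the group presented by
   the generators S and the relations (s t)^m(s,t) = 1. *)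
Inductive coxeter_congr (m : S -> S -> nat) : seq S -> seq S -> Prop :=
| coxeter_congr_refl x : coxeter_congr m x x
| coxeter_congr_sym x y : coxeter_congr m x y -> coxeter_congr m y x
| coxeter_congr_trans x y z :
    coxeter_congr m x y -> coxeter_congr m y z -> coxeter_congr m x z
| coxeter_congr_insert x y s t : (0 < m s t)%N ->
    coxeter_congr m (x ++ y) (x ++ flatten (nseq (m s t) [:: s; t]) ++ y).

Definition coxeter_system : Prop :=
  exists m : S -> S -> nat,
    [/\ coxeter_matrix m,
        forall w : W, exists x : seq S, word_prod x = w
      & forall x y : seq S, word_prod x = word_prod y <-> coxeter_congr m x y].

Definition has_word_of_size (w : W) (k : nat) : Prop :=
  exists2 x : seq S, size x = k & word_prod x = w.

(* The default value 0 is only reached when S does not generate w. *)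
Definition len (w : W) : nat :=
  xget 0%N [set k | has_word_of_size w k /\
                    forall j, has_word_of_size w j -> (k <= j)%N].

Definition weak_le (u v : W) : Prop := len v = (len u + len (u^-1 * v))%N.

Definition weak_itv (u v : W) : set W :=
  [set w | weak_le u w /\ weak_le w v].

Definition generated (J : set W) : set W :=
  smallest [set H : set W | group_closed [in H]] J.

Definition min_coset_reps (J : set W) : set W :=
  [set x | forall s, J s -> (len x < len (x * s))%N].

(* x^J; in a Coxeter system the set below is a singleton. *)
Definition min_part (J : set W) (x : W) : W :=
  xget 1 [set y | min_coset_reps J y /\ generated J (y^-1 * x)].

Definition coxeter_vertex (s w : W) : W := min_part ([set` S] `\ s) w.

Definition coxeter_facet (w : W) : {fset W * W} :=
  [fset (coxeter_vertex s w, s) | s in S]%fset.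

End Coxeter.

(** * Pure simplicial complexes *)

(* Complexes of pure dimension k - 1, so that the facets have k vertices and
   dimension -1 (the complex {empty set}) is allowed. *)
Record pure_complex (V : choiceType) (k : nat) := PureComplex {
  faces : set {fset V};
  faces_closed : forall F G : {fset V}, faces F -> (G `<=` F)%fset -> faces G;
  faces_pure : forall F : {fset V}, faces F ->
    exists G : {fset V}, [/\ faces G, (F `<=` G)%fset & #|` G|%fset = k]
}.

Section LinearShellability.
Variables (V : choiceType) (k : nat) (X : pure_complex V k).

Definition facets : set {fset V} :=
  [set F | faces X F /\
           forall G : {fset V}, faces X G -> (F `<=` G)%fset -> G = F].

Definition vertices : set V := [set x | exists2 F, faces X F & x \in F].

End LinearShellability.

(* Labels are 0, ..., n - 1 instead of 1, ..., n. *)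
Definition incr_tuple (n k : nat) : Type :=
  {t : k.-tuple 'I_n | sorted ltn [seq val i | i <- t]}.

Definition incr_tuple_seq n k (x : incr_tuple n k) : seq 'I_n := val x.
Coercion incr_tuple_seq : incr_tuple >-> seq.

Definition gale_le n k (x y : incr_tuple n k) : Prop :=
  forall i : 'I_k, (tnth (val x) i <= tnth (val y) i)%N.

(* Subsets are compared through their membership predicates: the exclusive or
   (+) is the symmetric difference. *)
Definition shelling_order n k h (C : 'I_h -> incr_tuple n k) : Prop :=
  injective C /\
  forall i j : 'I_h, (i < j)%N ->
    exists (r : 'I_h) (a b : 'I_n),
      [/\ (r < j)%N,
          forall c : 'I_n, (c \in (C r : seq _)) =
                           (c \in (C j : seq _)) (+) (c \in [:: a; b]),
          (a \in (C j : seq _)) && (a \notin (C i : seq _))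
        & (b \in (C r : seq _)) && (b \notin (C j : seq _))].

(* The image of the map induced on facets by the labelling [sigma]. *)
Definition label_image (V : choiceType) k (X : pure_complex V k) n
    (sigma : V -> nat) : set (incr_tuple n k) :=
  [set t | exists2 F, facets X F &
     [seq val i | i <- (t : seq 'I_n)] =i [fset sigma x | x in F]%fset].

Definition linear_extension n k (A : set (incr_tuple n k)) h
    (C : 'I_h -> incr_tuple n k) : Prop :=
  [/\ injective C, range C = A
    & forall i j : 'I_h, gale_le (C i) (C j) -> (i <= j)%N].

Definition linearly_shellable (V : choiceType) k (X : pure_complex V k) : Prop :=
  exists (n : nat) (sigma : V -> nat),
    set_bij (vertices X) `I_n sigma /\
    exists (h : nat) (C : 'I_h -> incr_tuple n k),
      linear_extension (label_image X (n := n) sigma) C /\ shelling_order C.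

(** * The complex C(u,v) *)

Section CoxeterComplex.
Variables (W : groupType) (S : {fset W}) (u v : W).

Definition coxeter_faces : set {fset W * W} :=
  [set F | exists2 w, weak_itv S u v w & (F `<=` coxeter_facet S w)%fset].

Fact coxeter_faces_closed (F G : {fset W * W}) :
  coxeter_faces F -> (G `<=` F)%fset -> coxeter_faces G.
Proof. by case=> w uwv Fw GF; exists w => //; apply: fsubset_trans Fw. Qed.

Fact coxeter_faces_pure (F : {fset W * W}) : coxeter_faces F ->
  exists G : {fset W * W},
    [/\ coxeter_faces G, (F `<=` G)%fset & #|` G|%fset = #|` S|%fset].
Proof.
case=> w uwv Fw; exists (coxeter_facet S w); split=> //; first by exists w.
by apply: card_imfset => s t [].
Qed.

Definition coxeter_complex : pure_complex (W * W)%type #|` S|%fset :=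
  PureComplex coxeter_faces_closed coxeter_faces_pure.

End CoxeterComplex.

(* Main.v *)
(** Label the vertices in an order of nondecreasing length of the coset
    representative. By the exchange condition, each projection w |-> w^J changes
    along a cover w < ws only by becoming strictly longer, so w <=_R w' implies
    P(w) <= P(w') in the Gale order, and every linear extension of the Gale order
    is a linear extension of the weak order on [u,v]_R. Any such extension is a
    shelling: given w_i before w_j, if P(w_i) and P(w_j) agreed at every right
    descent of g = u^-1 w_j, then w_i would lie in w_j W_K with g minimal in
    g W_K, whence w_j <=_R w_i; so they differ at some descent s, and w_j s gives
    the required adjacent facet. The exchange condition is read off the
    presentation: the parity of the multiplicity of a reflection among those
    attached to a word is invariant under the relations. *)

Require Import Defs.
From mathcomp Require Import all_boot.
From mathcomp Require Import finmap.
From mathcomp Require Import boolp classical_sets functions zify.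

Set Implicit Arguments.
Unset Strict Implicit.
Unset Printing Implicit Defensive.

Local Open Scope classical_set_scope.

(** * Increasing tuples and the Gale order *)

(** If the entry of [b] at [i] were smaller than that of [a], take it as the threshold [m]: at least
    [i + 1] entries of [b] are at most [m], but at most [i] entries of [a] are. *)
Lemma sorted_nth_le_count (a b : seq nat) i :
  sorted leq a -> sorted leq b -> (i < size a)%N -> (i < size b)%N ->
  (forall m, count (leq^~ m) b <= count (leq^~ m) a)%N ->
  (nth 0 a i <= nth 0 b i)%N.
Proof.
move=> sa sb ia ib ab; rewrite leqNgt; apply/negP => lt_ba.
set m := nth 0 b i in lt_ba; have := ab m; apply/negP; rewrite -ltnNge.
apply: (@leq_ltn_trans i).
  rewrite -{1}(cat_take_drop i a) count_cat.
  have -> : count (leq^~ m) (drop i a) = 0%N.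
    apply/eqP; rewrite -leqn0 leqNgt -has_count; apply/hasPn => x.
    case/(nthP 0) => j; rewrite size_drop nth_drop => ltj <-; rewrite -ltnNge.
    apply: leq_trans lt_ba _; apply: (sorted_leq_nth leq_trans leqnn) => //.
      by rewrite inE -ltn_subRL.
    exact: leq_addr.
  by rewrite addn0 (leq_trans (count_size _ _)) // size_take ia.
rewrite -(cat_take_drop i.+1 b) count_cat.
suff : all (leq^~ m) (take i.+1 b).
  by rewrite all_count => /eqP->; rewrite size_takel // leq_addr.
apply/allP => x /(nthP 0)[j]; rewrite size_takel // => ltj <-.
rewrite nth_take //; apply: (sorted_leq_nth leq_trans leqnn) => //.
by rewrite inE (leq_trans ltj).
Qed.

Section Gale.
Variables n k : nat.
Implicit Types x y : incr_tuple n k.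

Definition labels x : seq nat := [seq val i | i <- (x : seq 'I_n)].

Lemma size_labels x : size (labels x) = k.
Proof. by rewrite size_map size_tuple. Qed.

Lemma nth_labels x (i : 'I_k) : nth 0 (labels x) i = tnth (val x) i.
Proof.
rewrite (nth_map (tnth (val x) i)) ?size_tuple //.
by rewrite [in RHS](tnth_nth (tnth (val x) i)).
Qed.

Lemma sorted_labels x : sorted ltn (labels x).
Proof. exact: valP x. Qed.

Lemma mem_labels x (c : 'I_n) : (val c \in labels x) = (c \in (x : seq 'I_n)).
Proof. exact/mem_map/val_inj. Qed.

Lemma incr_tuple_of_seq (l : seq nat) :
  uniq l -> size l = k -> all (ltn^~ n) l -> exists x, labels x =i l.
Proof.
move=> uniq_l size_l l_lt; pose s := sort leq l.
pose t : seq 'I_n := pmap insub s.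
have val_t : [seq val i | i <- t] = s.
  rewrite /t pmap_filter; last exact: insubK.
  apply/all_filterP; rewrite all_sort.
  by apply: sub_all l_lt => c ltc; rewrite isSome_insub.
have size_t : size t == k by rewrite -(size_map val) val_t size_sort size_l.
have sorted_t : sorted ltn [seq val i | i <- Tuple size_t].
  by rewrite /= val_t ltn_sorted_uniq_leq sort_uniq uniq_l sort_sorted //; apply: leq_total.
exists (exist _ (Tuple size_t) sorted_t) => c.
by rewrite /labels /= val_t mem_sort.
Qed.

(** Any matching of the two label sets that only raises labels is enough, even if it is not the
    order-preserving one, because the counts below each threshold already compare. *)
Lemma gale_le_labels (I : finType) (f g : I -> nat) x y :
  injective f -> injective g -> (forall i, f i <= g i)%N ->
  labels x =i codom f -> labels y =i codom g -> gale_le x y.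
Proof.
move=> injf injg le_fg defx defy i; rewrite -!nth_labels.
have sorted_le z : sorted leq (labels z).
  by apply: sub_sorted (sorted_labels z) => ? ? /ltnW.
apply: sorted_nth_le_count; rewrite ?size_labels // => m.
have perm (h : I -> nat) (z : incr_tuple n k) :
    injective h -> labels z =i codom h -> perm_eq (labels z) (codom h).
  move=> injh; apply: uniq_perm; last by rewrite map_inj_uniq ?enum_uniq.
  exact: (sorted_uniq ltn_trans ltnn (sorted_labels z)).
rewrite (permP (perm f x injf defx)) (permP (perm g y injg defy)) !count_map.
by apply: sub_count => j /=; apply: leq_trans.
Qed.

Lemma gale_le_sum_eq x y : gale_le x y ->
  (\sum_(i < k) tnth (val y) i <= \sum_(i < k) tnth (val x) i)%N -> x = y.
Proof.
move=> le_xy le_sum; apply/val_inj/eq_from_tnth => i; apply/val_inj.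
apply/eqP; rewrite eqn_leq [X in X && _]le_xy /=; move: le_sum.
rewrite (bigD1 i) //= [X in (_ <= X)%N -> _](bigD1 i) //=.
move=> le_sum'; rewrite -(leq_add2r (\sum_(j < k | j != i) tnth (val x) j)).
by apply: leq_trans le_sum'; rewrite leq_add2l; apply: leq_sum.
Qed.

(** Sorting by the sum of the entries works, since this sum strictly increases along the Gale
    order. *)
Lemma linear_extension_exists (A : set (incr_tuple n k)) :
  exists h (C : 'I_h -> incr_tuple n k), linear_extension A C.
Proof.
pose sum x := (\sum_(i < k) tnth (val x) i)%N.
pose T : finType := {t : k.-tuple 'I_n | sorted ltn [seq val i | i <- t]}.
pose le : rel T := fun x y => (sum x <= sum y)%N.
pose s : seq T := sort le [seq x <- enum T | `[< A x >]].
have mem_s (x : T) : reflect (A x) (x \in s).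
  by rewrite mem_sort mem_filter mem_enum andbT; apply: asboolP.
have uniq_s : uniq s by rewrite sort_uniq filter_uniq ?enum_uniq.
have le_tr : transitive le by move=> ? ? ?; apply: leq_trans.
have sorted_s : sorted le s by apply: sort_sorted => ? ?; apply: leq_total.
exists (size s), (tnth (in_tuple s)).
have inj_C : injective (tnth (in_tuple s)) by apply/tuple_uniqP.
have le_C (i j : 'I_(size s)) : (i < j)%N ->
    le (tnth (in_tuple s) i) (tnth (in_tuple s) j).
  move=> lt_ij; have x0 := tnth (in_tuple s) i.
  rewrite (tnth_nth x0 (in_tuple s) i) (tnth_nth x0 (in_tuple s) j).
  apply: (sorted_leq_nth le_tr) => //; try exact: ltn_ord.
    by move=> ?; apply: leqnn.
  exact: ltnW.
split=> // [|i j le_ij].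
  apply/seteqP; split=> [_ [i _ <-] | x /mem_s s_x].
    by apply/mem_s; apply: (mem_tnth i (in_tuple s)).
  by have /tnthP[i ->] : x \in in_tuple s by []; exists i.
rewrite leqNgt; apply/negP => lt_ji.
have /inj_C eq_ij := gale_le_sum_eq le_ij (le_C _ _ lt_ji).
by rewrite eq_ij ltnn in lt_ji.
Qed.

End Gale.

Local Open Scope group_scope.

(** * Words, reflections and the exchange condition *)

Section CoxeterTheory.
Variables (W : groupType) (S : {fset W}).

Implicit Types (x y z : seq S) (s t : S) (w g h : W) (J : set W).

Lemma word_prod0 : word_prod ([::] : seq S) = 1.
Proof. by rewrite /word_prod big_nil. Qed.

Lemma word_prod_cons s x : word_prod (s :: x) = val s * word_prod x.
Proof. by rewrite /word_prod big_cons. Qed.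

Lemma word_prod_cat x y : word_prod (x ++ y) = word_prod x * word_prod y.
Proof. by rewrite /word_prod big_cat. Qed.

Lemma word_prod_rcons x s : word_prod (rcons x s) = word_prod x * val s.
Proof. by rewrite -cats1 word_prod_cat word_prod_cons word_prod0 mulg1. Qed.

Lemma word_prod_alternating s t n :
  word_prod (flatten (nseq n [:: s; t])) = (val s * val t) ^+ n.
Proof.
elim: n => [|n IHn]; first exact: word_prod0.
by rewrite /= !word_prod_cons IHn expgS mulgA.
Qed.

(* [word_prod x * r], for r in this list, is the product of x with one letter
   deleted. *)
Fixpoint reflections (x : seq S) : seq W :=
  if x is s :: y then (val s ^ word_prod y) :: reflections y else [::].

Lemma reflections_cat x y :
  reflections (x ++ y) = [seq r ^ word_prod y | r <- reflections x] ++ reflections y.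
Proof. by elim: x => //= s x ->; rewrite word_prod_cat conjgM. Qed.

Definition word_over J x : Prop := forall s, s \in x -> J (val s).

Lemma word_over_cat J x y : word_over J (x ++ y) <-> word_over J x /\ word_over J y.
Proof.
split=> [Jxy | [Jx Jy] s]; last by rewrite mem_cat => /orP[/Jx|/Jy].
by split=> s sx; apply: Jxy; rewrite mem_cat sx ?orbT.
Qed.

Lemma word_over_cons J s x : word_over J (s :: x) <-> J (val s) /\ word_over J x.
Proof.
split=> [Jsx | [Js Jx] t]; last by rewrite inE => /predU1P[-> | /Jx].
by split=> [|t xt]; apply: Jsx; rewrite inE ?eqxx ?xt ?orbT.
Qed.

Hypothesis coxS : coxeter_system S.

Lemma gen_sqr s : val s * val s = 1.
Proof.
have [m [[_ m1] _ mP]] := coxS.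
have m11 : m s s = 1%N by apply/m1.
have : word_prod ([::] : seq S) = word_prod [:: s; s].
  apply/mP; have := @coxeter_congr_insert _ _ m [::] [::] s s.
  by rewrite m11 /=; apply.
by rewrite !word_prod_cons word_prod0 mulg1.
Qed.

Lemma gen_inv s : (val s)^-1 = val s.
Proof. exact: mulg1_eq (gen_sqr s). Qed.

Lemma mulgenK w s : w * val s * val s = w.
Proof. by rewrite -mulgA gen_sqr mulg1. Qed.

Lemma word_prod_rev x : word_prod (rev x) = (word_prod x)^-1.
Proof.
elim: x => [|s x IHx]; first by rewrite word_prod0 invg1.
by rewrite rev_cons word_prod_rcons word_prod_cons invgM IHx gen_inv.
Qed.

(** Conjugation by [t] inverts [s t], so every reflection of this dihedral word takes the form
    [t (s t)^j]. The list becomes periodic once a power of [s t] is trivial. *)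
Lemma reflections_alternating s t n :
  reflections (flatten (nseq n [:: s; t])) =
  rev [seq val t * (val s * val t) ^+ j | j <- iota 0 n.*2].
Proof.
set c := val s * val t.
have tc k : val t ^ (c ^+ k) = val t * c ^+ k.*2.
  have ct : c ^ val t = c^-1.
    by rewrite /c conjgE invgM !gen_inv mulgenK.
  have ckt : (c ^+ k)^-1 * val t = val t * c ^+ k.
    by rewrite -[(c ^+ k)^-1]expVgn -ct -conjXg conjgE gen_inv !mulgA mulgenK.
  by rewrite conjgE mulgA ckt -mulgA -expgnDr addnn.
elim: n => [|n IHn] //; rewrite doubleS.
have -> : n.*2.+2 = (n.*2 + 2)%N by rewrite addn2.
rewrite iotaD map_cat rev_cat /= -IHn add0n /rev /=.
rewrite word_prod_cons word_prod_alternating -/c tc; congr (_ :: _ :: _).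
have -> : val s ^ (val t * c ^+ n) = (val t * c) ^ (c ^+ n).
  by rewrite conjgM (conjgE (val s)) gen_inv.
rewrite conjMg tc.
by rewrite -mulgA (_ : c ^ _ = c) -?expgSr // conjgE -expgS expgSr mulKg.
Qed.

(** An inserted relator has product 1, so it does not change the reflections contributed by the
    letters around it, and it contributes each reflection an even number of times itself. *)
Lemma odd_count_reflections x y r : word_prod x = word_prod y ->
  odd (count_mem r (reflections x)) = odd (count_mem r (reflections y)).
Proof.
have [m [[_ m1] _ mP]] := coxS; move/mP.
elim=> // [{}x {}y z _ -> _ -> // | {}x {}y s t mst].
set b := flatten _.
have b1 : word_prod b = 1.
  have /mP := @coxeter_congr_insert _ _ m [::] [::] s t mst.
  by rewrite !cats0 /= word_prod0 => <-.
rewrite !reflections_cat word_prod_cat b1 mul1g !count_cat !oddD.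
congr (_ (+) _); rewrite -[LHS]addFb; congr (_ (+) _).
rewrite count_map /b reflections_alternating count_rev count_map.
(* The exponents split into two halves of length [m s t]; by [b1] the shift between them does not
   change the reflection, so the two counts agree. *)
rewrite -addnn iotaD count_cat oddD add0n.
set p := preim _ _.
have -> : count p (iota (m s t) (m s t)) = count p (iota 0 (m s t)); last first.
  by rewrite addbb.
rewrite -[X in iota X _]addn0 iotaDl count_map; apply: eq_count => j /=.
by rewrite expgnDr -word_prod_alternating -/b b1 mul1g.
Qed.

(** Relators have even length. Hence multiplying by a generator can never preserve the length. *)
Lemma odd_size_word x y : word_prod x = word_prod y -> odd (size x) = odd (size y).
Proof.
have [m [_ _ mP]] := coxS; move/mP.
elim=> // [{}x {}y z _ -> _ -> // | {}x {}y s t _].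
suff even_b : odd (size (flatten (nseq (m s t) [:: s; t]))) = false.
  by rewrite !size_cat !oddD even_b.
by elim: (m s t) => //= n ->.
Qed.

Lemma mem_reflections x r : r \in reflections x ->
  exists x1 s x2, x = x1 ++ s :: x2 /\ word_prod x * r = word_prod (x1 ++ x2).
Proof.
elim: x => //= s x IHx; rewrite inE => /predU1P[-> | /IHx[x1 [t [x2 [-> xr]]]]].
  exists [::], s, x; split=> //.
  by rewrite word_prod_cons conjgE !mulgA mulgK gen_sqr mul1g.
by exists (s :: x1), t, x2; split=> //=; rewrite !word_prod_cons -mulgA xr.
Qed.

Lemma word_of w : exists2 x : seq S, word_prod x = w & size x = len S w.
Proof.
have [m [_ surj _]] := coxS; have [x xw] := surj w.
pose P k := `[< has_word_of_size S w k >].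
have exP : exists k, P k by exists (size x); apply/asboolP; exists x.
rewrite /len; case: xgetP => [k -> [[y]] | ] /=; first by move=> ? ? _; exists y.
case: (ex_minnP exP) => k /asboolP Pk mink /(_ k)[]; split=> // j Pj.
(* The least size of a word for [w] exists, so the default of [xget] is not reached. *)
exact/mink/asboolP.
Qed.

Lemma len_word x : (len S (word_prod x) <= size x)%N.
Proof.
rewrite /len; case: xgetP => [k _ [_ /(_ (size x))] | _ //] /=.
by apply; exists x.
Qed.

Lemma odd_len_word x : odd (len S (word_prod x)) = odd (size x).
Proof.
by have [y yx <-] := word_of (word_prod x); apply: odd_size_word.
Qed.

Lemma len_mul g h : (len S (g * h) <= len S g + len S h)%N.
Proof.
have [x <- <-] := word_of g; have [y <- <-] := word_of h.
by rewrite -word_prod_cat -size_cat len_word.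
Qed.

Lemma len1 : len S 1 = 0%N.
Proof. by apply/eqP; rewrite -leqn0 -word_prod0 len_word. Qed.

Lemma len_inv g : len S g^-1 = len S g.
Proof.
have lenV h : (len S h^-1 <= len S h)%N.
  by have [x <- <-] := word_of h; rewrite -word_prod_rev -(size_rev x) len_word.
by apply/eqP; rewrite eqn_leq lenV -{1}[g]invgK lenV.
Qed.

Lemma len_gen s : len S (val s) = 1%N.
Proof.
have s1 : word_prod [:: s] = val s by rewrite word_prod_cons word_prod0 mulg1.
by have := len_word [:: s]; have := odd_len_word [:: s]; rewrite s1; case: len => [|[]].
Qed.

Lemma len_mulgen g s :
  len S (g * val s) = (len S g).+1 \/ len S g = (len S (g * val s)).+1.
Proof.
have : odd (len S (g * val s)) = ~~ odd (len S g).
  have [x <- _] := word_of g.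
  by rewrite -word_prod_rcons !odd_len_word size_rcons.
have := len_mul g (val s); have := len_mul (g * val s) (val s).
by rewrite mulgenK len_gen; lia.
Qed.

(** Odd multiplicity of [s] in a word forces a descent: move the parity to a reduced word and delete
    a letter there. If the multiplicity in [x] were even, it would be odd in [x s], so [s] would be
    a descent of [x s] and not of [x]. *)
Lemma descent_reflections x s :
  (len S (word_prod x * val s) < len S (word_prod x))%N -> val s \in reflections x.
Proof.
have deleted y : odd (count_mem (val s) (reflections y)) ->
    (len S (word_prod y * val s) < len S (word_prod y))%N.
  have [z zy sz] := word_of (word_prod y).
  rewrite -(odd_count_reflections _ zy) => /odd_gt0; rewrite -has_count has_pred1.
  case/mem_reflections => z1 [t [z2 [def_z zs]]].
  rewrite -sz -zy zs (leq_ltn_trans (len_word _)) //.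
  by rewrite def_z !size_cat /= addnS.
move=> descent; rewrite -has_pred1 has_count odd_gt0 //.
have [//|/negPf even_x] := boolP (odd _).
have := deleted (rcons x s); rewrite word_prod_rcons mulgenK => /(_ _)/ltnW.
rewrite leqNgt descent; apply.
rewrite -cats1 reflections_cat count_cat /= word_prod0 conjg1 eqxx oddD /= addbT.
rewrite word_prod_cons word_prod0 mulg1 count_map.
have fix_s : val s ^ val s = val s by rewrite conjgE gen_sqr mulg1 gen_inv.
rewrite (@eq_count _ _ (pred1 (val s))) ?even_x // => r /=.
by rewrite -{2}fix_s (inj_eq (conjg_inj _)).
Qed.

(** The deleted letter lies in [x] or in [y]. In the first case only the shortening of the left
    factor is recorded, which is what minimality arguments use. *)
Lemma exchange_cat x y s :
  (len S (word_prod (x ++ y) * val s) < len S (word_prod (x ++ y)))%N ->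
  (exists2 x' : seq S, (size x' < size x)%N &
     word_prod (x ++ y) * val s = word_prod x' * word_prod y) \/
  (exists y1 t y2, y = y1 ++ t :: y2 /\ word_prod y * val s = word_prod (y1 ++ y2)).
Proof.
move/descent_reflections; rewrite reflections_cat mem_cat.
case/orP=> [/mapP[r /mem_reflections[x1 [t [x2 [def_x xr]]]] ->] | /mem_reflections];
  last by right.
left; exists (x1 ++ x2); first by rewrite def_x !size_cat /= addnS.
by rewrite word_prod_cat -mulgA -conjgC mulgA xr.
Qed.

Lemma len_eq0 g : len S g = 0%N -> g = 1.
Proof.
by have [x <- <-] := word_of g; move/size0nil->; rewrite word_prod0.
Qed.

(** * Parabolic subgroups and minimal coset representatives *)

Section Parabolic.
Variable J : set W.
Hypothesis sJS : (J `<=` [set` S])%classic.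

Lemma generatedP g : generated J g <-> exists2 x : seq S, word_over J x & word_prod x = g.
Proof.
split=> [|[x Jx <-]].
- apply: (@smallest_sub _ _ J
    [set h | exists2 x : seq S, word_over J x & word_prod x = h]%classic).
    split; rewrite /= ?inE; first by exists [::]; rewrite ?word_prod0.
    move=> g1 g2; rewrite !inE => -[x Jx <-] [y Jy <-].
    exists (x ++ rev y); last by rewrite word_prod_cat word_prod_rev.
    by apply/word_over_cat; split=> // s; rewrite mem_rev => /Jy.
  move=> s Js /=; have Ss : s \in S by exact: sJS.
  exists [:: [` Ss]%fset]; first by move=> t; rewrite inE => /eqP->.
  by rewrite word_prod_cons word_prod0 mulg1.
- move=> H [clH sJH]; have HM := group_closedM clH; case: clH; rewrite inE => H1 _.
  elim: x Jx => [|s x IHx]; first by rewrite word_prod0.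
  case/word_over_cons=> /sJH Hs /IHx Hx; rewrite word_prod_cons.
  by have := HM (val s) (word_prod x); rewrite !inE; apply.
Qed.

Lemma generated_word x : word_over J x -> generated J (word_prod x).
Proof. by move=> Jx; apply/generatedP; exists x. Qed.

Lemma generated1 : generated J 1.
Proof. by rewrite -word_prod0; apply: generated_word. Qed.

Lemma generatedM g h : generated J g -> generated J h -> generated J (g * h).
Proof.
case/generatedP=> x Jx <- /generatedP[y Jy <-]; rewrite -word_prod_cat.
by apply: generated_word; apply/word_over_cat.
Qed.

Lemma generatedV g : generated J g -> generated J g^-1.
Proof.
case/generatedP=> x Jx <-; rewrite -word_prod_rev.
by apply: generated_word => s; rewrite mem_rev => /Jx.
Qed.

Lemma generated_gen s : J (val s) -> generated J (val s).
Proof. by move=> Js H [_]; apply. Qed.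

(* A word over J can be shortened to one which stays reduced after g: a letter
   deleted by the exchange condition cannot come from g, by minimality. *)
Lemma shortest_word_over g x :
  (forall h, generated J h -> len S g <= len S (g * h))%N -> word_over J x ->
  exists2 y, word_over J y &
    word_prod y = word_prod x /\ len S (g * word_prod y) = (len S g + size y)%N.
Proof.
move=> min_g; have [G defG sG] := word_of g.
elim/last_ind: x => [|x s IHx]; first by exists [::]; rewrite ?word_prod0 ?mulg1 ?addn0.
rewrite -cats1 => /word_over_cat[/IHx[y Jy [defx leny]] /word_over_cons[Js _]].
rewrite cats1 word_prod_rcons -defx.
have [up | down] := len_mulgen (g * word_prod y) s.
  exists (rcons y s); first by rewrite -cats1 word_over_cat word_over_cons; split.
  by rewrite word_prod_rcons mulgA up size_rcons addnS leny.
have := @exchange_cat G y s; rewrite word_prod_cat defG down => /(_ (leqnn _)).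
case=> [[G' ltG' eqG'] | [y1 [t [y2 [def_y ys]]]]].
  (* This conjugate of [s] lies in the subgroup and carries [g] to the product of the shorter word
     [G']. *)
  have := min_g (word_prod y * val s * (word_prod y)^-1); rewrite !mulgA eqG' mulgK.
  suff Jh : generated J (word_prod y * val s * (word_prod y)^-1).
    by move=> /(_ Jh); have := len_word G'; lia.
  apply: generatedM; last by apply: generatedV; apply: generated_word.
  by apply: generatedM; [apply: generated_word | apply: generated_gen].
exists (y1 ++ y2).
  by move: Jy; rewrite def_y !word_over_cat word_over_cons => -[? []].
rewrite -ys mulgA; split=> //.
by move: leny; rewrite down def_y !size_cat /= !addnS => -[].
Qed.

Lemma reduced_word_over h : generated J h ->
  exists2 y : seq S, word_over J y & word_prod y = h /\ size y = len S h.
Proof.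
case/generatedP=> x Jx <-; have [|y Jy] := @shortest_word_over 1 x _ Jx.
  by rewrite len1.
by rewrite mul1g len1 => -[<- ->]; exists y.
Qed.

Lemma min_rep_exists w : exists2 g, generated J (g^-1 * w) &
  (forall h, generated J h -> len S g <= len S (g * h))%N.
Proof.
pose P k := `[< exists2 h, generated J h & len S (w * h) = k >].
have exP : exists k, P k.
  by exists (len S w); apply/asboolP; exists 1; [exact: generated1 | rewrite mulg1].
case: (ex_minnP exP) => k /asboolP[h Jh <-] min_h; exists (w * h) => [|h' Jh'].
  by rewrite invgM mulgVK; apply: generatedV.
by apply/min_h/asboolP; exists (h * h'); rewrite ?mulgA //; apply: generatedM.
Qed.

(** Additivity holds for a shortest element [g'] of the coset, by [shortest_word_over]; having no
    descent in [J] forces [g] to be that element. *)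
Lemma len_mul_min g h : min_coset_reps S J g -> generated J h ->
  len S (g * h) = (len S g + len S h)%N.
Proof.
have additive g' h' : (forall h, generated J h -> len S g' <= len S (g' * h))%N ->
    generated J h' -> len S (g' * h') = (len S g' + len S h')%N.
  move=> min_g' /generatedP[x Jx <-].
  have [y _ [<- leny]] := shortest_word_over min_g' Jx.
  by have := len_mul g' (word_prod y); have := len_word y; lia.
move=> Jg Jh; have [g' Jgg' min_g'] := min_rep_exists g.
suff -> : g = g' by exact: additive.
have [y Jy [defy sy]] := reduced_word_over Jgg'.
have leng := additive _ _ min_g' Jgg'; rewrite mulVKg -sy in leng.
have {defy} defg : g = g' * word_prod y by rewrite defy mulVKg.
(* If [y] were nonempty, its last letter would be a descent of [g] in [J]. *)
case/lastP: y Jy defg {sy} leng => [|y s]; first by rewrite word_prod0 mulg1.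
rewrite -cats1 word_over_cat word_over_cons => -[_ [Js _]].
rewrite cats1 word_prod_rcons mulgA size_rcons => defg leng.
have := Jg _ Js; rewrite leng defg mulgenK.
move=> lt_gs; exfalso; have := leq_trans lt_gs (len_mul g' (word_prod y)).
by have := len_word y; lia.
Qed.

Lemma min_coset_reps_inj g h : min_coset_reps S J g -> min_coset_reps S J h ->
  generated J (g^-1 * h) -> g = h.
Proof.
move=> Jg Jh Jgh.
have := len_mul_min Jg Jgh; have := len_mul_min Jh (generatedV Jgh).
rewrite len_inv invgM invgK mulVKg mulVKg => lenh leng.
have /len_eq0 gh1 : len S (g^-1 * h) = 0%N by lia.
by rewrite -[h](mulVKg g) gh1 mulg1.
Qed.

Lemma min_partP w :
  min_coset_reps S J (min_part S J w) /\ generated J ((min_part S J w)^-1 * w).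
Proof.
rewrite /min_part; case: xgetP => [y -> [] // | /=].
have [g Jg min_g] := min_rep_exists w; case/(_ g); split=> // s Js.
have Ss : s \in S by exact: sJS.
have up := min_g s (@generated_gen [` Ss]%fset Js).
by case: (len_mulgen g [` Ss]%fset) => [-> // | down]; rewrite down ltnn in up.
Qed.

Lemma min_part_eq w w' : generated J (w^-1 * w') <-> min_part S J w = min_part S J w'.
Proof.
have [min_w Jw] := min_partP w; have [min_w' Jw'] := min_partP w'.
split=> [Jww' | eq_ww'].
  apply: min_coset_reps_inj => //.
  have := generatedM (generatedM Jw Jww') (generatedV Jw').
  by rewrite invgM invgK -!mulgA !mulVKg.
have := generatedM (generatedV Jw) Jw'.
by rewrite -eq_ww' invgM invgK -!mulgA !mulVKg.
Qed.

Lemma len_min_part g w : generated J (g^-1 * w) -> (len S (min_part S J w) <= len S g)%N.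
Proof.
move/min_part_eq <-; have [min_g Jg] := min_partP g.
by rewrite -{2}[g](mulVKg (min_part S J g)) (len_mul_min min_g Jg) leq_addr.
Qed.

(** Write [w s] as its minimal part followed by a word over [J], and apply exchange at its descent
    [s]. A letter deleted from the word over [J] leaves the coset unchanged; one deleted from the
    minimal part gives the coset of [w] a shorter element. *)
Lemma min_part_cover w s : len S (w * val s) = (len S w).+1 ->
  min_part S J w = min_part S J (w * val s) \/
  (len S (min_part S J w) < len S (min_part S J (w * val s)))%N.
Proof.
set z := w * val s => lenz; have [_] := min_partP z; set g := min_part S J z => Jgz.
have [x defg sx] := word_of g; have [y Jy defy] := (generatedP _).1 Jgz.
have defz : word_prod (x ++ y) = z by rewrite word_prod_cat defg defy mulVKg.
have zs : z * val s = w by rewrite /z mulgenK.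
have := @exchange_cat x y s; rewrite defz zs lenz => /(_ (leqnn _)).
case=> [[x' ltx' defw] | [y1 [t [y2 [def_y ys]]]]].
  right; rewrite -sx; apply: leq_ltn_trans ltx'; apply: leq_trans (len_word x').
  by apply: len_min_part; rewrite defw mulKg; apply: generated_word.
left; apply/min_part_eq; rewrite -{1}zs -{2}(mulgenK z s) zs.
have -> : w^-1 * (w * val s) = (word_prod (y1 ++ y2))^-1 * word_prod y.
  by rewrite -ys invgM gen_inv mulgVK mulKg.
apply: generatedM; last exact: generated_word.
apply: generatedV; apply: generated_word.
by move: Jy; rewrite def_y !word_over_cat word_over_cons => -[? []].
Qed.

(* The projection to minimal coset representatives is not monotone for the weak
   order, only for the Bruhat order; this is what survives on lengths. *)
Lemma min_part_weak_le w w' : weak_le S w w' ->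
  min_part S J w = min_part S J w' \/
  (len S (min_part S J w) < len S (min_part S J w'))%N.
Proof.
have [x defx sx] := word_of (w^-1 * w'); rewrite /weak_le -sx.
have {defx sx} -> : w' = w * word_prod x by rewrite defx mulVKg.
elim: x w => [|s x IHx] w; first by rewrite word_prod0 mulg1; left.
rewrite word_prod_cons mulgA => lenw.
have {}lenw : len S (w * val s * word_prod x) = (len S w + (size x).+1)%N := lenw.
have lenx := len_word x; have lewsx := len_mul (w * val s) (word_prod x).
(* Lengths add up along the whole word, so its first letter must lengthen [w]. *)
have lenws : len S (w * val s) = (len S w).+1 by have := len_mulgen w s; lia.
have := IHx (w * val s); rewrite lenw lenws addSnnS => /(_ erefl).
case: (min_part_cover lenws) => [-> // | lt1] [<- | lt2]; right => //.
exact: ltn_trans lt2.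
Qed.

End Parabolic.

Lemma generated_support J s : (J `<=` [set` S])%classic ->
  generated J (val s) -> J (val s).
Proof.
move=> sJS /(reduced_word_over sJS)[x Jx []]; rewrite len_gen.
case: x Jx => [|t [|? ?]] //= Jt; rewrite word_prod_cons word_prod0 mulg1 => <- _.
by apply: Jt; rewrite mem_head.
Qed.

(** No reduced word of [w] ends in a letter [s] of [D]: exchange in a word for [w] avoiding [s]
    would put [s] in the subgroup generated by the other generators. A last letter outside [D] lies
    in all the subgroups concerned and can be peeled off. *)
Lemma generated_bigcap (D : set W) w :
  (forall s, D (val s) -> generated ([set` S] `\ val s) w) ->
  generated ([set` S] `\` D) w.
Proof.
have sDS : ([set` S] `\` D `<=` [set` S])%classic by move=> ? [].
have sdS s : ([set` S] `\ val s `<=` [set` S])%classic by move=> ? [].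
have [x <- sx] := word_of w; elim/last_ind: x sx => [|x s IHx].
  by move=> _ _; rewrite word_prod0; apply: generated1.
rewrite size_rcons word_prod_rcons => sx Dx.
have lenx := len_word x; have lenM := len_mul (word_prod x) (val s).
rewrite len_gen in lenM.
have nDs : ~ D (val s).
  move=> Ds; have [y Jy defy] := (generatedP (sdS s) _).1 (Dx _ Ds).
  have lt_sx : (len S (word_prod ([::] ++ y) * val s) < len S (word_prod ([::] ++ y)))%N.
    by rewrite cat0s defy mulgenK -sx ltnS.
  case: (exchange_cat lt_sx) => [[?] // | [y1 [t [y2 [def_y ys]]]]].
  suff /(generated_support (sdS s))[_] : generated ([set` S] `\ val s) (val s) by apply.
  rewrite -[X in generated _ X](mulKg (word_prod x)) -defy.
  apply: (generatedM (sdS s)); last exact: (generated_word (sdS s) Jy).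
  rewrite -[word_prod x](mulgenK _ s) -defy ys; apply: (generatedV (sdS s)).
  apply: generated_word => //.
  by move: Jy; rewrite def_y !word_over_cat word_over_cons => -[? []].
have Ds : generated ([set` S] `\` D) (val s).
  by apply: generated_gen => //; split=> //=; apply: valP.
apply: (generatedM sDS) Ds; apply: IHx => [|t Dt]; first by lia.
rewrite -[word_prod x](mulgenK _ s); apply: (generatedM (sdS t)); first exact: Dx.
apply: generated_gen => //; split=> /=; first exact: valP.
by move=> st; apply: nDs; rewrite (st : val s = val t).
Qed.

(** * Weak order intervals and Coxeter vertices *)

Lemma weak_le_trans w1 w2 w3 : weak_le S w1 w2 -> weak_le S w2 w3 -> weak_le S w1 w3.
Proof.
rewrite /weak_le => le12 le23.
have le13 : (len S (w1^-1 * w3) <= len S (w1^-1 * w2) + len S (w2^-1 * w3))%N.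
  by rewrite -{1}(mulVKg w2 w3) mulgA len_mul.
have le3 : (len S w3 <= len S w1 + len S (w1^-1 * w3))%N.
  by rewrite -{1}(mulVKg w1 w3) len_mul.
by lia.
Qed.

Lemma weak_le_len w1 w2 : weak_le S w1 w2 -> (len S w1 <= len S w2)%N.
Proof. by move->; exact: leq_addr. Qed.

(** Makes weak intervals, and so the vertex set of the complex, finite. *)
Lemma finite_len_ball n : exists L : seq W, forall w, (len S w <= n)%N -> w \in L.
Proof.
suff [L LP] : exists L : seq W, forall x, (size x <= n)%N -> word_prod x \in L.
  by exists L => w; have [x <- <-] := word_of w; apply: LP.
elim: n => [|n [L LP]].
  by exists [:: 1] => x; rewrite leqn0 => /nilP->; rewrite word_prod0 mem_head.
exists (1 :: [seq val s * g | s <- enum {: S}, g <- L]) => -[|s x] /=.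
  by rewrite word_prod0 mem_head.
rewrite ltnS => /LP Lx; rewrite word_prod_cons inE; apply/orP; right.
by apply: (allpairs_f (fun (s : S) g => val s * g)); rewrite ?mem_enum.
Qed.

Let sDS s : ([set` S] `\ val s `<=` [set` S])%classic.
Proof. by move=> ? []. Qed.

(** With [coxeter_vertex_neq], this says that the facets of [w] and [w s] differ exactly in their
    vertex of type [s]. *)
Lemma coxeter_vertex_mulgen s t w : t != s ->
  coxeter_vertex S (val t) (w * val s) = coxeter_vertex S (val t) w.
Proof.
move=> ts; apply/esym/(min_part_eq (@sDS t)); rewrite mulKg.
apply: generated_gen; split; first exact: valP.
by move/val_inj => st; rewrite st eqxx in ts.
Qed.

Lemma coxeter_vertex_neq s w :
  coxeter_vertex S (val s) (w * val s) <> coxeter_vertex S (val s) w.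
Proof.
move/esym/(min_part_eq (@sDS s)); rewrite mulKg.
by case/(generated_support (@sDS s)) => _; apply.
Qed.

Lemma coxeter_vertex_weak_le s w w' : weak_le S w w' ->
  coxeter_vertex S (val s) w = coxeter_vertex S (val s) w' \/
  (len S (coxeter_vertex S (val s) w) < len S (coxeter_vertex S (val s) w'))%N.
Proof. exact/min_part_weak_le/sDS. Qed.

(* With g = u^-1 w and K the complement of the right descent set of g, equality
   of all the vertices at descents of g puts w' in w W_K, while g is minimal in
   g W_K, so that lengths add along w' = u g (w^-1 w'). *)
Lemma weak_itv_descent u v w w' : weak_itv S u v w -> weak_itv S u v w' ->
  weak_le S w w' \/
  exists s : S, [/\ weak_itv S u v (w * val s), weak_le S (w * val s) w &
                coxeter_vertex S (val s) w' <> coxeter_vertex S (val s) w].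
Proof.
move=> [le_uw le_wv] [le_uw' le_w'v]; pose g := u^-1 * w.
pose D : set W := fun h => (len S (g * h) < len S g)%N.
(* Since the lengths of [u] and [g] add up to that of [w], this bound makes each descent of [g] a
   descent of [w], and [w s] stays above [u]. *)
have gen_w (s : S) : (len S (w * val s) <= len S u + len S (g * val s))%N.
  by rewrite -{1}(mulVKg u w) -/g -mulgA len_mul.
have in_itv (s : S) : D (val s) -> weak_itv S u v (w * val s) /\ weak_le S (w * val s) w.
  move=> Ds; have {}Ds : (len S (g * val s) < len S g)%N := Ds.
  have lew := gen_w s; have updown := len_mulgen w s; have updown' := len_mulgen g s.
  have le_wsw : weak_le S (w * val s) w.
    rewrite /weak_le invgM mulgVK gen_inv len_gen.
    by move: le_uw; rewrite /weak_le -/g; lia.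
  split=> //; split; last exact: weak_le_trans le_wv.
  have ug : u^-1 * (w * val s) = g * val s by rewrite mulgA.
  rewrite /weak_le ug.
  by move: le_uw; rewrite /weak_le -/g; lia.
have [[s [Ds neq]] | no_s] := pselect (exists s : S, D (val s) /\
    coxeter_vertex S (val s) w' <> coxeter_vertex S (val s) w).
  by right; exists s; have [] := in_itv s Ds.
left; pose K := [set` S] `\` D; set z := w^-1 * w'.
have Kz : generated K z.
  apply: generated_bigcap => s Ds; apply: (min_part_eq (@sDS s) _ _).2; apply: contrapT => neq.
  by apply: no_s; exists s; split; [exact: Ds | exact/nesym].
have sKS : K `<=` [set` S] by move=> ? [].
have min_g : min_coset_reps S K g.
  move=> h [Sh /negP]; rewrite -leqNgt => le_g.
  by case: (len_mulgen g [` Sh]%fset) le_g => /= -> //; rewrite ltnn.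
have := len_mul_min sKS min_g Kz; rewrite /weak_le -/z.
move: le_uw le_uw'; rewrite /weak_le -/g => -> ->.
have -> : u^-1 * w' = g * z by rewrite /g /z -mulgA mulVKg.
by move=> ->; rewrite addnA.
Qed.

End CoxeterTheory.

(** * Facets, vertex labelling and shelling of the complex *)

Section CoxeterComplex.
Variables (W : groupType) (S : {fset W}) (u v : W).

Implicit Types (s : S) (w : W).

Lemma coxeter_facetP w (p : W * W) :
  reflect (exists s, p = (coxeter_vertex S (val s) w, val s)) (p \in coxeter_facet S w).
Proof.
apply: (iffP (imfsetP _ _ _ _)) => [[s /= Ss ->] | [s ->]]; first by exists [` Ss]%fset.
by exists (val s) => //; apply: valP.
Qed.

Lemma card_coxeter_facet w : #|` coxeter_facet S w|%fset = #|` S|%fset.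
Proof. by apply: card_imfset => s t []. Qed.

Lemma facets_coxeter_complex F : facets (coxeter_complex S u v) F <->
  exists2 w, weak_itv S u v w & F = coxeter_facet S w.
Proof.
split=> [[[w uwv Fw] maxF] | [w uwv ->]].
  by exists w => //; apply/esym/maxF => //; exists w.
split=> [|G [w' uw'v Gw'] wG]; first by exists w.
apply/esym/eqP; rewrite eqEfcard wG card_coxeter_facet -(card_coxeter_facet w').
exact: fsubset_leq_card.
Qed.

Lemma vertices_coxeter_complex p : vertices (coxeter_complex S u v) p <->
  exists2 w, weak_itv S u v w & p \in coxeter_facet S w.
Proof.
split=> [[F [w uwv Fw] Fp] | [w uwv wp]]; first by exists w => //; apply: (fsubsetP Fw).
by exists (coxeter_facet S w) => //; exists w.
Qed.

Hypothesis coxS : coxeter_system S.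

(** Ties in length may be broken arbitrarily: along the weak order a vertex of given type either
    stays the same or gets a strictly longer representative. *)
Lemma vertex_enumeration : exists V : seq (W * W),
  [/\ uniq V, sorted (fun p q => len S p.1 <= len S q.1)%N V &
      forall p, p \in V <-> vertices (coxeter_complex S u v) p].
Proof.
have [L LP] := finite_len_ball coxS (len S v).
pose V := undup [seq (coxeter_vertex S (val s) w, val s) |
                 w <- [seq w <- L | `[< weak_itv S u v w >]], s <- enum {: S}].
exists (sort (fun p q => len S p.1 <= len S q.1)%N V); split.
- by rewrite sort_uniq undup_uniq.
- by apply: sort_sorted => p q; apply: leq_total.
move=> p; rewrite mem_sort mem_undup vertices_coxeter_complex; split.
  case/allpairsP=> -[w s] /= []; rewrite mem_filter => /andP[/asboolP uwv _] _ ->.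
  by exists w => //; apply/coxeter_facetP; exists s.
case=> w uwv /coxeter_facetP[s ->].
apply: (allpairs_f (fun w (s : S) => (coxeter_vertex S (val s) w, val s))).
  by rewrite mem_filter LP ?(weak_le_len uwv.2) // andbT; apply/asboolP.
by rewrite mem_enum.
Qed.

Lemma coxeter_complex_linearly_shellable : linearly_shellable (coxeter_complex S u v).
Proof.
have [V [uniqV sortedV memV]] := vertex_enumeration.
pose sigma p := index p V; exists (size V), sigma.
have itvV w s : weak_itv S u v w -> (coxeter_vertex S (val s) w, val s) \in V.
  move=> uwv; apply/memV/vertices_coxeter_complex; exists w => //.
  by apply/coxeter_facetP; exists s.
split.
  split=> [p /memV Vp | p q | i ltiV].
  - by rewrite /= index_mem.
  - by rewrite !inE => /memV Vp /memV Vq; apply: (index_inj p).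
  have p0 : W * W by case: (V) ltiV => [|p ?].
  by exists (nth p0 V i); [apply/memV/mem_nth | apply: index_uniq].
have [h [C linC]] :=
  linear_extension_exists (label_image (coxeter_complex S u v) (n := size V) sigma).
exists h, C; split=> //; have [injC rangeC linearC] := linC.
pose f w s := sigma (coxeter_vertex S (val s) w, val s).
have f_inj w w' s t : weak_itv S u v w -> weak_itv S u v w' -> f w s = f w' t ->
    s = t /\ coxeter_vertex S (val s) w = coxeter_vertex S (val t) w'.
  move=> uwv uw'v eq_f.
  by have [-> /val_inj->] := index_inj (1, 1) (itvV _ s uwv) (itvV _ t uw'v) eq_f.
have f_le w w' s : weak_itv S u v w -> weak_itv S u v w' -> weak_le S w w' ->
    (f w s <= f w' s)%N.
  move=> uwv uw'v le_ww'; rewrite leqNgt; apply/negP => lt_f.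
  have : (len S (coxeter_vertex S (val s) w') <= len S (coxeter_vertex S (val s) w))%N.
    apply: (sorted_leq_index _ _ sortedV _ _ (itvV _ s uw'v) (itvV _ s uwv)) (ltnW lt_f).
      by move=> ? ? ?; apply: leq_trans.
    by move=> ?; apply: leqnn.
  case: (coxeter_vertex_weak_le coxS s le_ww') => [eq_v | lt_v]; last by rewrite leqNgt lt_v.
  by rewrite /f eq_v ltnn in lt_f.
have fsetE w : [fset sigma p | p in coxeter_facet S w]%fset =i codom (f w).
  move=> c; apply/imfsetP/codomP => [[p /coxeter_facetP[s ->] ->] | [s ->]]; first by exists s.
  by exists (coxeter_vertex S (val s) w, val s) => //; apply/coxeter_facetP; exists s.
have imageP i : exists2 w, weak_itv S u v w & labels (C i) =i codom (f w).
  have : range C (C i) by exists i.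
  rewrite rangeC => -[F /facets_coxeter_complex[w uwv ->] labC].
  by exists w => // c; rewrite -fsetE -labC.
have imageS w : weak_itv S u v w -> exists i, labels (C i) =i codom (f w).
  move=> uwv; have [|||x labx] := @incr_tuple_of_seq (size V) #|` S|%fset (codom (f w)).
  - by rewrite map_inj_uniq ?enum_uniq // => s t /f_inj[].
  - by rewrite size_codom cardfE.
  - by apply/allP => _ /codomP[s ->]; rewrite /= index_mem itvV.
  have : range C x.
    rewrite rangeC; exists (coxeter_facet S w).
      by apply/facets_coxeter_complex; exists w.
    by move=> c; rewrite fsetE -labx.
  by case=> i _ defx; exists i => c; rewrite defx labx.
(* Matching the vertices of the two facets by type gives the Gale comparison. *)
have gale w w' i j : weak_itv S u v w -> weak_itv S u v w' -> weak_le S w w' ->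
    labels (C i) =i codom (f w) -> labels (C j) =i codom (f w') -> (i <= j)%N.
  move=> uwv uw'v le_ww' labi labj; apply: linearC.
  apply: gale_le_labels labi labj; [by move=> ? ? /f_inj[] | by move=> ? ? /f_inj[] |].
  by move=> s; apply: f_le.
split=> // i j lt_ij.
have [wi uwiv labi] := imageP i; have [wj uwjv labj] := imageP j.
have [le_w | [s [uwjsv le_w neq_s]]] := weak_itv_descent coxS uwjv uwiv.
  by have := gale _ _ _ _ uwjv uwiv le_w labj labi; rewrite leqNgt lt_ij.
have [r labr] := imageS _ uwjsv.
have lt_f w : weak_itv S u v w -> (f w s < size V)%N by move=> uwv; rewrite index_mem itvV.
(* The labels [a] and [b] are those of the type [s] vertices of [wj] and of [wj s]. *)
exists r, (Ordinal (lt_f _ uwjv)), (Ordinal (lt_f _ uwjsv)).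
have f_other t : t != s -> f (wj * val s) t = f wj t.
  by move=> ts; rewrite /f (coxeter_vertex_mulgen coxS).
have a_r : f wj s \notin codom (f (wj * val s)).
  apply/codomP => -[t /f_inj[//|//|<-]]; exact/nesym/coxeter_vertex_neq.
have b_j : f (wj * val s) s \notin codom (f wj).
  by apply/codomP => -[t /f_inj[//|//|<-]]; apply: coxeter_vertex_neq.
(* A label determines the type of its vertex, so only the type [s] vertex of [wi] could carry this
   one, and [neq_s] rules that out. *)
have a_i : f wj s \notin codom (f wi).
  by apply/codomP => -[t /f_inj[//|//|<-]] /esym.
split.
(* The weak order only gives [r <= j]; equality fails because [b] labels a vertex of [C r] but none
   of [C j]. *)
- rewrite ltn_neqAle (gale _ _ _ _ uwjsv uwjv le_w labr labj) andbT.
  by apply: contra b_j => /eqP/val_inj eq_rj; rewrite -labj -eq_rj labr codom_f.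
- move=> c; rewrite -!mem_labels labr labj !inE -!val_eqE /=.
  have [-> | neq_a] := eqVneq; first by rewrite (negPf a_r) codom_f.
  have [-> | neq_b] := eqVneq; first by rewrite (negPf b_j) codom_f.
  rewrite addbF; apply/codomP/codomP => -[t def_c]; exists t.
  + by rewrite def_c f_other //; apply: contraNneq neq_b => ts; rewrite def_c ts.
  + by rewrite def_c f_other //; apply: contraNneq neq_a => ts; rewrite def_c ts.
- by rewrite -!mem_labels labj labi /= codom_f.
- by rewrite -!mem_labels labj labr /= codom_f.
Qed.

End CoxeterComplex.

Local Close Scope group_scope.
Local Close Scope classical_set_scope.

Theorem theorem4p8 (W : groupType) (S : {fset W}) (u v : W) :
  coxeter_system S -> weak_le S u v ->
  linearly_shellable (coxeter_complex S u v).
Proof. by move=> coxS _; apply: coxeter_complex_linearly_shellable. Qed.
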